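(* Let $\alpha>0$ be an irrational real number and let $L_1>1$, $L_2>1$ be real numbers. Let $\mathcal{P}_\alpha\subset\mathbb{R}^2$ be the polygon $$\mathcal{P}_\alpha=\big([-\alpha,\alpha]\times[1-L_1,1]\big)\ \cup\ \big([-1,1]\times[1,1+L_2]\big).$$ Then the polygonal billiard $\mathcal{P}_\alpha$ does not have the finite blocking property. That is, there exists a pair $(O,A)$ of points of $\mathcal{P}_\alpha$ such that for every finite set $\{B_1,\dots,B_n\}$ of points of $\mathcal{P}_\alpha$, all different from $O$ and $A$, some billiard trajectory in $\mathcal{P}_\alpha$ from $O$ to $A$ meets none of the $B_i$.
   Context: Billiard trajectories: in a planar polygon $\mathcal{P}$, a point moves in a straight line in the interior. When it hits the relative interior of a side of the boundary it is reflected by the usual law (angle of incidence equals angle of reflection). A trajectory is not continued past a vertex of the polygon. A billiard trajectory from $O$ to $A$ is a finite-length path of this kind starting at $O$ and ending at $A$. The boundary of $\mathcal{P}_\alpha$ is its topological boundary in $\mathbb{R}^2$, so the common part of the segments $[-\alpha,\alpha]\times\{1\}$ and $[-1,1]\times\{1\}$ is (apart from its endpoints) interior to $\mathcal{P}_\alpha$ and is not a wall. Finite blocking property: a planar polygonal billiard $\mathcal{P}$ has the finite blocking property if for every pair $(O,A)$ of points in $\mathcal{P}$ there exists a finite number of points $B_1,\dots,B_n$ in $\mathcal{P}$ (different from $O$ and $A$) such that every billiard trajectory from $O$ to $A$ meets one of the $B_i$. *)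

(* Defs.v *)
From HB Require Import structures.
From mathcomp Require Import all_boot all_order all_algebra.
From mathcomp Require Import all_classical all_reals all_analysis.
Import Order.TTheory GRing.Theory Num.Theory.
Import numFieldNormedType.Exports.

Set Implicit Arguments.
Unset Strict Implicit.
Unset Printing Implicit Defensive.

Local Open Scope classical_set_scope.
Local Open Scope ring_scope.

Section Billiard.
Variable R : realType.

(* The product topology is the usual one; the max norm that the library puts on
   a product is not used. *)
Local Notation plane := (R^o * R^o)%type.
Implicit Types (P : set plane) (O A a b c d u v x y z : plane) (p : nat -> plane).

Definition dotp u v : R := u.1 * v.1 + u.2 * v.2.

Definition segment a b : set plane :=
  [set a + t *: (b - a) | t in `[(0 : R), 1]].

Definition open_segment a b : set plane :=
  [set a + t *: (b - a) | t in `](0 : R), 1[].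

Definition boundary P : set plane := closure P `\` interior P.

(* A polygon is given as a closed region of the plane; its sides are the
   maximal nondegenerate segments contained in its boundary. *)
Definition side P a b : Prop :=
  [/\ a != b, segment a b `<=` boundary P &
      forall c d, segment a b `<=` segment c d ->
        segment c d `<=` boundary P -> segment c d = segment a b].

(* The linear reflection that fixes u and negates the vectors orthogonal to u. *)
Definition reflection u v : plane := (2 * dotp v u / dotp u u) *: u - v.

(* A path arriving at y from x leaves y towards z: y is in the relative
   interior of a side, and the outgoing direction is the mirror image of the
   incoming one.  The factor c accounts for the unequal lengths of [x,y] and
   [y,z]. *)
Definition reflected_at P x y z : Prop :=
  exists a b, [/\ side P a b, open_segment a b y &
    exists2 c : R, 0 < c & z - y = c *: reflection (b - a) (y - x)].

(* The broken line p 0, ..., p n, whose intermediate points are the bounces.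
   Consecutive points are distinct and n > 0: otherwise a motionless path from
   O to O, which no point other than O can block, would be a trajectory.
   Only p 0 and p n may be vertices. *)
Definition billiard_trajectory P O A (n : nat) p : Prop :=
  [/\ (0 < n)%N, p 0%N = O, p n = A,
      forall i, (i < n)%N ->
        p i != p i.+1 /\ open_segment (p i) (p i.+1) `<=` interior P &
      forall i, (i.+1 < n)%N -> reflected_at P (p i) (p i.+1) (p i.+2)].

Definition trajectory_support (n : nat) p : set plane :=
  \bigcup_(i in `I_n) segment (p i) (p i.+1).

Definition finite_blocking_property P : Prop :=
  forall O A, P O -> P A ->
    exists B : set plane,
      [/\ finite_set B, B `<=` P, ~ B O, ~ B A &
          forall n p, billiard_trajectory P O A n p ->
            exists2 b, B b & trajectory_support n p b].

Definition table (alpha L1 L2 : R) : set plane :=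
  (`[- alpha, alpha] `*` `[1 - L1, 1]) `|` (`[- 1, 1] `*` `[1, 1 + L2]).

End Billiard.

(* Main.v *)
Require Import Defs.
From mathcomp Require Import all_boot all_order all_algebra.
From mathcomp Require Import all_classical all_reals all_analysis.
From mathcomp Require Import zify ring lra.
Import Order.TTheory GRing.Theory Num.Theory.
Import numFieldNormedType.Exports.
Local Open Scope ring_scope.

Set Implicit Arguments.
Unset Strict Implicit.

(** Take O = (0, 0) and A = (0, 2), both at distance 1 from the common line y = 1.
    Unfolding each rectangle across its vertical walls turns a trajectory from O
    to A without horizontal bounces into a straight line in each half.  If p, q
    are positive integers with |q - alpha p| < min(1, alpha) / 2, the line of
    horizontal speed 2 (alpha p + q) leaves O, crosses y = 1 at
    |x| = 2 |q - alpha p|, hence inside the opening, and reaches A after 2 p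
    bounces below and 2 q bounces above.
    A point (x, y) with 0 < y <= 1 lies on this trajectory only if
    y (alpha p + q) = +/- x / 2 + alpha k for an integer k; by irrationality the
    solutions (p, q) for a given sign lie on a line of rational slope, which meets
    the strip around q = alpha p in finitely many integer points.  The same holds
    for the upper half, so finitely many points block only finitely many of these
    trajectories. *)

(** * Rectangular neighbourhoods, vertical sides and reflections *)

Section PlaneRegions.
Variable R : realType.
Local Notation plane := (R^o * R^o)%type.
Implicit Types (P : set plane) (u z : plane).

Lemma nbhs_planeP P (x0 y0 : R) :
  nbhs ((x0, y0) : plane) P <-> exists2 e : R, 0 < e &
    forall x y : R, `|x0 - x| < e -> `|y0 - y| < e -> P (x, y).
Proof.
split=> [/nbhs_ballP [e /= e0 eP]|[e e0 eP]].
  by exists e => // x y xe ye; apply: eP; split.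
by apply/nbhs_ballP; exists e => //= -[x y] [/= xe ye]; exact: eP.
Qed.

Lemma interior_rect P (x0 x1 y0 y1 x y : R) :
  (forall x y, x0 < x < x1 -> y0 < y < y1 -> P (x, y)) ->
  x0 < x < x1 -> y0 < y < y1 -> interior P (x, y).
Proof.
move=> sub /andP[x0x xx1] /andP[y0y yy1]; apply/nbhs_planeP.
pose e := Num.min (Num.min (x - x0) (x1 - x)) (Num.min (y - y0) (y1 - y)).
have [e1 e2 e3 e4] : [/\ e <= x - x0, e <= x1 - x, e <= y - y0 & e <= y1 - y].
  by rewrite /e; split; rewrite !ge_min lexx ?orbT.
exists e; first by rewrite !lt_min !subr_gt0 x0x xx1 y0y.
move=> x2 y2 /=; rewrite !ltr_norml => /andP[u1 u2] /andP[v1 v2].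
by apply: sub; lra.
Qed.

Lemma not_closure_rect P (x0 x1 y0 y1 x y : R) :
  (forall x y, x0 < x < x1 -> y0 < y < y1 -> ~ P (x, y)) ->
  x0 < x < x1 -> y0 < y < y1 -> ~ closure P (x, y).
Proof.
move=> sub hx hy; have /[swap]/[apply] := @interior_rect (~` P)%classic _ _ _ _ _ _ sub hx hy.
by case=> z [].
Qed.

Lemma segment_pair (x0 y0 x1 y1 t : R) :
  (x0, y0) + t *: ((x1, y1) - (x0, y0) : plane) =
  (x0 + t * (x1 - x0), y0 + t * (y1 - y0)) :> plane.
Proof. by []. Qed.

Lemma vertical_segmentP (w y0 y1 : R) z : y0 < y1 ->
  segment (w, y0) (w, y1) z <-> z.1 = w /\ y0 <= z.2 <= y1.
Proof.
move=> y01; split=> [[t /=]|].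
  rewrite in_itv /= => /andP[t0 t1] <-; rewrite segment_pair /=.
  by split; [ring | apply/andP; split; nra].
case: z => x y /= [-> /andP[yy0 yy1]].
exists ((y - y0) / (y1 - y0)) => /=.
  by rewrite in_itv /= divr_ge0 ?ler_pdivrMr ?mul1r ?lerD2r//; lra.
rewrite segment_pair; congr pair; first by ring.
by field; lra.
Qed.

Lemma vertical_open_segment (w y0 y1 y : R) : y0 < y < y1 ->
  open_segment (w, y0) (w, y1) ((w, y) : plane).
Proof.
move=> /andP[yy0 yy1]; exists ((y - y0) / (y1 - y0)) => /=.
  by rewrite in_itv /= divr_gt0 ?ltr_pdivrMr ?mul1r ?ltrD2r//; lra.
rewrite segment_pair; congr pair; first by ring.
by field; lra.
Qed.

(* It is enough that boundary points accumulate nowhere on the prolongations of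
   the segment: the remaining boundary points of the line may be far away. *)
Lemma vertical_side P (w y0 y1 : R) : y0 < y1 ->
  (forall y, y0 <= y <= y1 -> boundary P (w, y)) ->
  (forall y, y < y0 -> exists2 y', y <= y' < y0 & ~ boundary P (w, y')) ->
  (forall y, y1 < y -> exists2 y', y1 < y' <= y & ~ boundary P (w, y')) ->
  side P (w, y0) (w, y1).
Proof.
move=> y01 bd below above; split.
- by apply/eqP => -[]; lra.
- by move=> [x y] /(vertical_segmentP _ _ y01) /= [-> ] /bd.
move=> [c1 c2] [d1 d2] sub sub_bd.
have [s /= s01 Es] : segment (c1, c2) (d1, d2) (w, y0).
  by apply/sub/vertical_segmentP => //=; split=> //; lra.
have [t /= t01 Et] : segment (c1, c2) (d1, d2) (w, y1).
  by apply/sub/vertical_segmentP => //=; split=> //; lra.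
move: s01 t01 Es Et; rewrite !in_itv /= => /andP[s0 s1] /andP[t0 t1].
rewrite !segment_pair => -[Es1 Es2] [Et1 Et2].
(* Two points of the larger segment share the abscissa [w] but differ in height, so [t] differs from
   [s] and the segment is vertical. *)
have dc1 : d1 = c1.
  have /eqP : (t - s) * (d1 - c1) = 0 by lra.
  rewrite mulf_eq0 => /orP[/eqP ts|/eqP]; last by lra.
  have : t = s by lra.
  by move=> ?; subst t; lra.
have cw : c1 = w by move: Es1; rewrite dc1; lra.
subst d1 c1.
have on_line y : Num.min c2 d2 <= y <= Num.max c2 d2 ->
    segment (w, c2) (w, d2) ((w, y) : plane).
  case: (ltgtP c2 d2) => [cd|dc|cd] /andP[h1 h2].
  - by apply/vertical_segmentP => //=; split=> //; lra.
  - exists ((c2 - y) / (c2 - d2)) => /=.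
      by rewrite in_itv /= divr_ge0 ?ler_pdivrMr ?mul1r//; lra.
    by rewrite segment_pair; congr pair; [ring | field; lra].
  - by exfalso; move: Es2 Et2; rewrite cd; lra.
have lo1 : Num.min c2 d2 <= y0 by rewrite ge_min; case: (leP c2 y0) => //= ?; case: (leP c2 d2) => ?; nra.
have hi1 : y1 <= Num.max c2 d2 by rewrite le_max; case: (leP y1 c2) => //= ?; case: (leP c2 d2) => ?; nra.
(* A longer segment would contain a prolongation below [y0], hence the non-boundary point supplied
   by [below]. *)
have lo : y0 <= Num.min c2 d2.
  rewrite leNgt; apply/negP => /below [y' /andP[h1 h2]]; apply.
  by apply/sub_bd/on_line; rewrite h1 /=; lra.
have hi : Num.max c2 d2 <= y1.
  rewrite leNgt; apply/negP => /above [y' /andP[h1 h2]]; apply.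
  by apply/sub_bd/on_line; rewrite h2 andbT; lra.
apply/seteqP; split=> // z [r /=]; rewrite in_itv /= => /andP[r0 r1] <-.
rewrite segment_pair; apply/vertical_segmentP => //=; split; first by ring.
move: lo hi; rewrite le_min ge_max => /andP[? ?] /andP[? ?].
by apply/andP; split; nra.
Qed.

(** Reflection in a vertical line keeps the rise and negates the horizontal speed [k] per unit of
    height; the rises [vy] and [wy] before and after may differ. *)
Lemma reflected_at_vertical P (w y0 y1 y k vy wy : R) u z :
  side P (w, y0) (w, y1) -> y0 < y < y1 -> 0 < vy -> 0 < wy ->
  (w, y) - u = (- (k * vy), vy) -> z - (w, y) = (k * wy, wy) ->
  reflected_at P u (w, y) z.
Proof.
move=> sd yy vy0 wy0 Ex Ez; exists (w, y0), (w, y1); split=> //.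
  exact: vertical_open_segment.
exists (wy / vy); first exact: divr_gt0.
have y01 : y1 - y0 != 0 by move: yy => /andP[? ?]; lra.
rewrite Ex Ez /reflection /dotp /= subrr !mulr0 !add0r.
by congr pair => /=; rewrite /GRing.scale /= ?mulr0; field; rewrite y01 gt_eqF.
Qed.

End PlaneRegions.

(** * Walls and interior of the table *)

Section Table.
Variables (R : realType) (alpha L1 L2 : R).
Local Notation plane := (R^o * R^o)%type.
Local Notation tbl := (table alpha L1 L2).

Lemma tableP (x y : R) : tbl (x, y) <->
  (- alpha <= x <= alpha /\ 1 - L1 <= y <= 1) \/
  (- 1 <= x <= 1 /\ 1 <= y <= 1 + L2).
Proof.
by split=> [[]|[]] [/= hx hy]; [left|right|left|right];
  split; rewrite /= ?in_itv //; move: hx hy; rewrite /= !in_itv.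
Qed.

(** For [alpha = 1] the walls of the two rectangles would merge into one side. Otherwise the wall
    stops at height 1: just above, the line [x = w] runs inside the table if [alpha < 1] and outside
    it if [alpha > 1]. *)
Lemma lower_wall (w : R) :
  0 < alpha -> alpha != 1 -> 0 < L1 -> 0 < L2 ->
  w = alpha \/ w = - alpha ->
  side tbl (w, (1 - L1 : R)) (w, (1 : R)).
Proof.
move=> a0 a_neq1 L1_gt0 L2_gt0 w_alpha; apply: vertical_side => [|y yy|y yy|y yy]; first by lra.
- split; first by apply: subset_closure; apply/tableP; lra.
  move=> /nbhs_planeP [e e0] /=.
  (* The test point moves outwards and also down, so that even for [y = 1] it misses the upper
     rectangle. *)
  pose s : R := if w == alpha then 1 else - 1.
  move=> /(_ (w + s * (e / 2)) (y - e / 2)) /=.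
  have hs : w = s * alpha /\ (s = 1 \/ s = -1).
    rewrite /s; case: eqP w_alpha => [-> _|]; first by lra.
    by move=> ? []; lra.
  case: hs => ws hs.
  rewrite (_ : w - _ = - (s * (e / 2))); last by ring.
  rewrite (_ : y - _ = e / 2); last by ring.
  rewrite normrN normrM.
  rewrite (_ : `|s| = 1) ?mul1r; last by case: hs => ->; rewrite ?normrN normr1.
  rewrite !gtr0_norm ?divr_gt0//.
  have h : e / 2 < e by lra.
  move=> /(_ h h) /tableP; rewrite ws; case: hs => ->; lra.
- exists y; first by rewrite lexx.
  move=> [] /(@not_closure_rect _ _ (w - 1) (w + 1) (y - 1) (1 - L1)) + _.
  by apply; first (by move=> ? ? ? ? /tableP; lra); lra.
- exists (Num.min y (1 + L2 / 2)); first by rewrite lt_min ge_min lexx/=; lra.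
  have : 1 < Num.min y (1 + L2 / 2) <= 1 + L2 / 2.
    by rewrite lt_min ge_min lexx orbT; lra.
  move: (Num.min _ _) => y' y'_bd.
  move=> [cl int]; have [a1|a1|a1] := ltgtP alpha 1.
  + apply: int; apply: (@interior_rect _ _ (-1) 1 1 (1 + L2)); try lra.
    by move=> ? ? ? ?; apply/tableP; lra.
  + case: w_alpha cl => ->.
      move=> /(@not_closure_rect _ _ 1 (alpha + 1) 1 (1 + L2)); apply; try lra.
      by move=> ? ? ? ? /tableP; lra.
    move=> /(@not_closure_rect _ _ (- alpha - 1) (-1) 1 (1 + L2)); apply; try lra.
    by move=> ? ? ? ? /tableP; lra.
  + by move: a_neq1; rewrite a1 eqxx.
Qed.

Lemma upper_wall (w : R) :
  0 < alpha -> alpha != 1 -> 0 < L1 -> 0 < L2 ->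
  w = 1 \/ w = - 1 ->
  side tbl (w, (1 : R)) (w, (1 + L2 : R)).
Proof.
move=> a0 a_neq1 L1_gt0 L2_gt0 w1; apply: vertical_side => [|y yy|y yy|y yy]; first by lra.
- split; first by apply: subset_closure; apply/tableP; lra.
  move=> /nbhs_planeP [e e0] /= /(_ (w + w * (e / 2)) (y + e / 2)) /=.
  rewrite (_ : w - _ = - (w * (e / 2))); last by ring.
  rewrite (_ : y - _ = - (e / 2)); last by ring.
  rewrite !normrN normrM.
  rewrite (_ : `|w| = 1) ?mul1r; last by case: w1 => ->; rewrite ?normrN normr1.
  rewrite !gtr0_norm ?divr_gt0//.
  have h : e / 2 < e by lra.
  by move=> /(_ h h) /tableP; case: w1 => ->; lra.
- exists (Num.max y (1 - L1 / 2)); first by rewrite gt_max le_max lexx/=; lra.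
  have : 1 - L1 / 2 <= Num.max y (1 - L1 / 2) < 1.
    by rewrite gt_max le_max lexx orbT; lra.
  move: (Num.max _ _) => y' y'_bd.
  move=> [cl int]; have [a1|a1|a1] := ltgtP alpha 1.
  + case: w1 cl => ->.
      move=> /(@not_closure_rect _ _ alpha 2 (1 - L1) 1); apply; try lra.
      by move=> ? ? ? ? /tableP; lra.
    move=> /(@not_closure_rect _ _ (- 2) (- alpha) (1 - L1) 1); apply; try lra.
    by move=> ? ? ? ? /tableP; lra.
  + apply: int; apply: (@interior_rect _ _ (- alpha) alpha (1 - L1) 1); try lra.
    by move=> ? ? ? ?; apply/tableP; lra.
  + by move: a_neq1; rewrite a1 eqxx.
- exists y; first by rewrite lexx andbT.
  move=> [] /(@not_closure_rect _ _ (w - 1) (w + 1) (1 + L2) (y + 1)) + _.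
  by apply; first (by move=> ? ? ? ? /tableP; lra); lra.
Qed.

Lemma table_interior (x y : R) :
  0 < alpha -> 0 < L1 -> 0 < L2 -> 1 - L1 < y < 1 + L2 ->
  (y <= 1 -> - alpha < x < alpha) -> (1 <= y -> - 1 < x < 1) ->
  interior tbl (x, y).
Proof.
move=> a0 L1_gt0 L2_gt0 hy lo hi; have [y1|y1|y1] := ltgtP y 1.
- apply: (@interior_rect _ _ (- alpha) alpha (1 - L1) 1); rewrite ?lo ?ltW//; last by lra.
  by move=> ? ? ? ?; apply/tableP; lra.
- apply: (@interior_rect _ _ (- 1) 1 1 (1 + L2)); rewrite ?hi ?ltW//; last by lra.
  by move=> ? ? ? ?; apply/tableP; lra.
have {}lo := lo ltac:(lra); have {}hi := hi ltac:(lra).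
(* On the common line [y = 1], the rectangle of half-width [m] passes through the opening and lies
   in the table on both sides. *)
pose m := Num.min alpha 1.
have ma : m <= alpha by rewrite /m ge_min lexx.
have m1 : m <= 1 by rewrite /m ge_min lexx orbT.
apply: (@interior_rect _ _ (- m) m (1 - L1) (1 + L2)) => //.
  by move=> ? y' ? ?; apply/tableP; case: (leP y' 1) => ?; lra.
by rewrite /m; case: (leP alpha 1) => ?; lra.
Qed.

End Table.

(** * Integer points in the strip around [q = a p] *)

Section Strip.
Variable R : realType.

Lemma irrational_lin (a : R) (p q : int) : irrational a ->
  a * p%:~R + q%:~R = 0 -> p = 0 /\ q = 0.
Proof.
move=> ia E; have p0 : p = 0.
  apply: contrapT => /eqP p0; apply: ia; exists (- q%:Q / p%:Q) => //.
  have : p%:~R != 0 :> R by rewrite intr_eq0.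
  by rewrite fmorph_div rmorphN /= !ratr_int => pn0; apply: (mulIf pn0); rewrite divfK//; lra.
by move: E; rewrite p0 mulr0 add0r => /eqP; rewrite intr_eq0 => /eqP.
Qed.

(* By irrationality, the solutions (p, q) of the equation lie on one line of
   rational slope, which leaves the strip around q = a p. *)
Lemma strip_solutions_bounded (a b z e : R) :
  irrational a -> b != 0 -> z != 0 ->
  exists N : nat, forall p q k : int, `|q%:~R - a * p%:~R| < 1 ->
    z * (a * p%:~R + q%:~R) = e + b * k%:~R -> p <= N%:Z.
Proof.
move=> ia b0 z0.
pose S (p q k : int) := `|q%:~R - a * p%:~R| < 1 /\
  z * (a * p%:~R + q%:~R) = e + b * k%:~R.
have [[p0 [q0 [k0 S0]]]|noS] :=
    pselect (exists p0 q0 k0, S p0 q0 k0); last first.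
  by exists 0%N => p q k h1 h2; exfalso; apply: noS; exists p, q, k.
have [[p1 [q1 [k1 [p10 S1]]]]|noS] :=
    pselect (exists p1 q1 k1, p1 != p0 /\ S p1 q1 k1); last first.
  exists `|p0|%N => p q k h1 h2; have [->|pp0] := eqVneq p p0; first by lia.
  by exfalso; apply: noS; exists p, q, k.
have {}p10 : p1 - p0 != 0 by rewrite subr_eq0.
set dp := p1 - p0 in p10; pose dq := q1 - q0; pose dk := k1 - k0.
have dpE : dp%:~R = p1%:~R - p0%:~R :> R by rewrite /dp intrB.
have dqE : dq%:~R = q1%:~R - q0%:~R :> R by rewrite /dq intrB.
have dkE : dk%:~R = k1%:~R - k0%:~R :> R by rewrite /dk intrB.
(* The drift across the strip along the direction [(dp, dq)] of the line of solutions; irrationality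
   makes it nonzero. *)
pose d : R := dq%:~R - a * dp%:~R.
have d0 : d != 0.
  apply/eqP => d0; case: (@irrational_lin a (- dp) dq ia); last by lia.
  by rewrite rmorphN /=; move: d0; rewrite /d; lra.
(* Two points of the strip differ by at most 2 across it, so a multiple of [(dp, dq)] joining them
   has abscissa at most [2 * |dp| / |d|] in absolute value. *)
exists (`|p0| + Num.bound (2 * `|dp%:~R| / `|d|))%N => p q k h1 h2.
pose Dp := p - p0; pose Dq := q - q0; pose Dk := k - k0.
have DpE : Dp%:~R = p%:~R - p0%:~R :> R by rewrite /Dp intrB.
have DqE : Dq%:~R = q%:~R - q0%:~R :> R by rewrite /Dq intrB.
have DkE : Dk%:~R = k%:~R - k0%:~R :> R by rewrite /Dk intrB.
case: S0 S1 => [s0 e0] [s1 e1].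
have E1 : z * (a * dp%:~R + dq%:~R) = b * dk%:~R by rewrite dpE dqE dkE; lra.
have E2 : z * (a * Dp%:~R + Dq%:~R) = b * Dk%:~R by rewrite DpE DqE DkE; lra.
have dk0 : dk != 0.
  apply/eqP => dk0; move: E1; rewrite dk0 mulr0 => /eqP.
  rewrite mulf_eq0 (negbTE z0) /= => /eqP /(irrational_lin ia) [].
  by move/eqP: p10.
(* Cross-multiplication eliminates [z] and [b]. By irrationality the coefficients of [a] and of 1
   then agree separately, so [(Dp, Dq)] is proportional to [(dp, dq)]. *)
have E3 : dk%:~R * (a * Dp%:~R + Dq%:~R) = Dk%:~R * (a * dp%:~R + dq%:~R).
  apply: (mulfI b0); rewrite !mulrA -E1 -E2; ring.
have [] := @irrational_lin a (dk * Dp - Dk * dp) (dk * Dq - Dk * dq) ia.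
  by rewrite !intrB !intrM; lra.
move=> /(congr1 (fun m : int => m%:~R : R)); rewrite intrB !intrM.
move=> F1 /(congr1 (fun m : int => m%:~R : R)); rewrite intrB !intrM => F2.
have F : Dp%:~R * d = (Dq%:~R - a * Dp%:~R) * dp%:~R.
  have dk0' : dk%:~R != 0 :> R by rewrite intr_eq0.
  apply: (mulfI dk0'); apply/eqP; rewrite -subr_eq0 /d; apply/eqP.
  transitivity ((dk%:~R * Dp%:~R - Dk%:~R * dp%:~R) * dq%:~R
    - (dk%:~R * Dq%:~R - Dk%:~R * dq%:~R) * dp%:~R : R); first by ring.
  by rewrite F1 F2 !mul0r subrr.
have sD : `|Dq%:~R - a * Dp%:~R| <= 2.
  move: h1 s0; rewrite !DqE !DpE !ltr_norml ler_norml => /andP[? ?] /andP[? ?].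
  by apply/andP; split; lra.
have : `|Dp%:~R| <= 2 * `|dp%:~R| / `|d|.
  rewrite ler_pdivlMr ?normr_gt0// -normrM F normrM.
  by rewrite ler_wpM2r.
move=> /le_lt_trans /(_ (archi_boundP _)) => /(_ ltac:(by rewrite divr_ge0// mulr_ge0)).
move: (Num.bound _) => M.
rewrite -intr_norm => hM.
have : `|Dp| < M%:Z by rewrite -(ltr_int R).
by rewrite /Dp; lia.
Qed.

Lemma nearest_nat (x : R) : 0 <= x ->
  (forall n : nat, x + 1 / 2 != n%:R) -> exists n : nat, `|n%:R - x| < 1 / 2.
Proof.
move=> x0 xn; exists (Num.truncn (x + 1 / 2)).
have /truncn_itv /andP[] : 0 <= x + 1 / 2 by lra.
rewrite le_eqVlt eq_sym (negbTE (xn _)) /= => h1.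
rewrite -[ltRHS]natr1 => h2.
by rewrite ltr_norml; apply/andP; split; lra.
Qed.

(** If [a >= 1], fix [p] and round [a p] to [q]; otherwise fix [q] and round [q / a], which exceeds
    [q], to [p]. Either way the error is below half of [min(1, a)], strictly since irrationality
    excludes ties. *)
Lemma strip_unbounded (a : R) (N : nat) : 0 < a -> irrational a ->
  exists p q : nat, [/\ (N < p)%N, (0 < q)%N,
    `|q%:R - a * p%:R| < 1 / 2 & `|q%:R - a * p%:R| < a / 2].
Proof.
move=> a0 ia; have [a1|a1] := leP 1 a.
  have N0 : 0 < N.+1%:R :> R by rewrite ltr0n.
  have [||q hq] := @nearest_nat (a * N.+1%:R).
  - by rewrite mulr_ge0// ltW.
  - move=> n; apply/eqP => E.
    case: (@irrational_lin a (2 * N.+1)%N%:Z (1 - (2 * n)%N%:Z) ia); last by lia.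
    by rewrite intrB -!pmulrn !natrM; lra.
  exists N.+1, q; split=> //; last by lra.
  rewrite -(ltr0n R); move: hq; rewrite ltr_norml => /andP[? ?].
  have h : 1 <= N.+1%:R :> R by rewrite ler1n.
  by nra.
have N0 : 0 < N.+1%:R :> R by rewrite ltr0n.
have [||p hp] := @nearest_nat (N.+1%:R / a).
- by rewrite divr_ge0 ?ltW.
- move=> n; apply/eqP => E.
  case: (@irrational_lin a (1 - (2 * n)%N%:Z) (2 * N.+1)%N%:Z ia); last by lia.
  rewrite intrB -!pmulrn !natrM; have {E} : N.+1%:R = (n%:R - 1 / 2) * a.
    by rewrite -E; field; rewrite gt_eqF.
  by lra.
exists p, N.+1; have E : `|N.+1%:R - a * p%:R| < a / 2.
  rewrite (_ : _ - _ = - (a * (p%:R - N.+1%:R / a))); last first.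
    by field; rewrite gt_eqF.
  by rewrite normrN normrM gtr0_norm// ltr_pM2l//; lra.
split=> //; last by lra.
rewrite -(ltr_nat R); move: hp; rewrite ltr_norml => /andP[h _].
have : N.+1%:R < N.+1%:R / a by rewrite ltr_pdivlMr//; nra.
by rewrite -[N.+1%:R]natr1 in h *; lra.
Qed.

End Strip.

(** * The unfolded line and its bounces *)

Section Trajectory.
Variables (R : realType) (a : R) (p q : nat).
Local Notation plane := (R^o * R^o)%type.

(* On its i-th segment the trajectory is the line x = +/- (slope * y - offset i).
   Truncating the count at both ends makes offset constant before 0 and after
   nbounce, so that the endpoints, like the bounces, lie at heights (times slope)
   halfway between two consecutive offsets. *)
Definition offset (i : nat) : R :=
  2 * (a * (minn i p.*2)%:R + (minn (i - p.*2) q.*2)%:R).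

Definition hit (i : nat) : R := (offset i.-1 + offset i) / 2.

Definition slope : R := 2 * (a * p%:R + q%:R).

(** [offset i] is the centre of the [i]-th unfolded copy of the table; the sign folds this copy
    back, since each bounce reverses left and right. *)
Definition vertex (i : nat) : plane :=
  ((- 1) ^+ i * (hit i - offset i), hit i / slope).

Definition nbounce := (p.*2 + q.*2)%N.

Lemma offset_lower i : (i <= p.*2)%N -> offset i = 2 * a * i%:R.
Proof.
move=> ip; rewrite /offset (minn_idPl ip) (eqP (_ : i - p.*2 == 0)%N) ?subn_eq0//.
by rewrite min0n; ring.
Qed.

Lemma offset_upper i : (p.*2 <= i <= nbounce)%N ->
  offset i = 4 * a * p%:R + 2 * (i%:R - 2 * p%:R).
Proof.
move=> /andP[pi iq]; rewrite /offset (minn_idPr pi).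
rewrite (minn_idPl (_ : i - p.*2 <= q.*2)%N) ?leq_subLR//.
by rewrite natrB// -mul2n natrM; ring.
Qed.

Lemma offset_last : offset nbounce.+1 = offset nbounce.
Proof.
rewrite /offset /nbounce !(minn_idPr _); try lia.
by congr (2 * (_ * _ + _)); rewrite ?(minn_idPr _)//; lia.
Qed.

Lemma hit0 : hit 0 = 0.
Proof. by rewrite /hit /= offset_lower// mulr0 addr0 mul0r. Qed.

Lemma hit_last : hit nbounce.+1 = 2 * slope.
Proof.
rewrite /hit /= offset_last offset_upper ?leq_addr ?leqnn// /slope /nbounce.
by rewrite natrD -!mul2n !natrM; field.
Qed.

Lemma hit_lower i : (0 < i <= p.*2)%N -> hit i = offset i - a.
Proof.
case: i => // i /= ip; rewrite /hit /= !offset_lower// ?(ltnW ip)//.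
by rewrite -natr1; field.
Qed.

Lemma hit_upper i : (p.*2 < i <= nbounce)%N -> hit i = offset i - 1.
Proof.
case: i => // i /andP[pi iq]; rewrite /hit /= !offset_upper; try lia.
by rewrite -[i.+1%:R]natr1; field.
Qed.

(** The wall is midway between two consecutive centres, so both copies fold the bounce to the same
    point. *)
Lemma hitS i : hit i.+1 - offset i = - (hit i.+1 - offset i.+1).
Proof. by rewrite /hit /=; field. Qed.

Lemma vertexS1 i : (vertex i.+1).1 = (-1) ^+ i * (hit i.+1 - offset i).
Proof. by rewrite hitS /vertex /= exprS; ring. Qed.

(** Here [s] is the abscissa on the unfolded line, that is, the height times [slope]. *)
Lemma vertex_segment i (r : R) :
  let s := hit i + r * (hit i.+1 - hit i) in
  vertex i + r *: (vertex i.+1 - vertex i) =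
  ((- 1) ^+ i * (s - offset i), s / slope) :> plane.
Proof.
rewrite /= [vertex i.+1]surjective_pairing vertexS1 segment_pair.
by congr pair; rewrite /=; ring.
Qed.

Definition strip : Prop := [/\ 0 < a, (0 < p)%N, (0 < q)%N,
  `|q%:R - a * p%:R| < 1 / 2 & `|q%:R - a * p%:R| < a / 2].

(** The unfolded line crosses [y = 1] at abscissa [slope], and [slope - 4 a p = 2 (q - a p)]:
    relative to the centre [4 a p] of copy [2 p], the crossing lies in the opening. *)
Lemma strip_slope : strip -> [/\ 0 < slope,
  4 * a * p%:R - a < slope < 4 * a * p%:R + a &
  4 * a * p%:R - 1 < slope < 4 * a * p%:R + 1].
Proof.
move=> [a0 p0 q0 h1 h2]; rewrite /slope.
have p0' : 0 < p%:R :> R by rewrite ltr0n.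
have q0' : 0 < q%:R :> R by rewrite ltr0n.
have ap : 0 < a * p%:R by rewrite mulr_gt0.
by move: h1 h2; rewrite !ltr_norml => /andP[? ?] /andP[? ?]; split; lra.
Qed.

(** These copies are left below [y = 1]. The entry point is only bounded because copy 0 is entered
    at its centre, the others at a wall. *)
Lemma step_lower i : strip -> (i < p.*2)%N ->
  [/\ - a <= hit i - offset i <= 0, 0 <= hit i, hit i.+1 = offset i + a &
      hit i.+1 < slope].
Proof.
move=> st ip; have [X0 /andP[X1 X2] X3] := strip_slope st; case: st => a0 _ _ _ _.
have E : hit i.+1 = offset i + a.
  by rewrite hit_lower// !offset_lower// ?(ltnW ip)// -[i.+1%:R]natr1; ring.
have lt : hit i.+1 < slope.
  rewrite E offset_lower ?(ltnW ip)//.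
  have : i%:R + 1 <= 2 * p%:R :> R by rewrite natr1 -natrM ler_nat mul2n.
  by move=> h; have := ler_wpM2l (ltW a0) h; lra.
move: E lt; have [->|i0] := posnP i => E lt.
  have S0 : offset 0 = 0 by rewrite offset_lower// mulr0.
  by split=> //; rewrite hit0 ?S0; lra.
have h : 1 <= i%:R :> R by rewrite ler1n.
have := ler_wpM2l (ltW a0) h.
have H : hit i = offset i - a by rewrite hit_lower// i0 ltnW.
have S : offset i = 2 * a * i%:R by rewrite offset_lower// ltnW.
by split; lra.
Qed.

(** Copy [2 p] contains the crossing: it is entered at a lower wall and left at an upper one. *)
Lemma step_middle : strip ->
  [/\ hit p.*2 = offset p.*2 - a, hit p.*2.+1 = offset p.*2 + 1 &
      offset p.*2 = 4 * a * p%:R].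
Proof.
move=> [a0 p0 q0 _ _].
have E : offset p.*2 = 4 * a * p%:R.
  by rewrite offset_lower// -mul2n natrM; ring.
split=> //; first by rewrite hit_lower//; lia.
rewrite hit_upper; last by rewrite /nbounce; lia.
rewrite E offset_upper; last by rewrite /nbounce; lia.
by rewrite -[p.*2.+1%:R]natr1 -mul2n natrM; ring.
Qed.

(** These copies are entered above [y = 1]. The exit is only bounded because the last copy ends at
    its centre, at [A]. *)
Lemma step_upper i : strip -> (p.*2 < i <= nbounce)%N ->
  [/\ hit i = offset i - 1, 0 <= hit i.+1 - offset i <= 1,
      hit i.+1 <= 2 * slope & slope < hit i].
Proof.
move=> st ip; have [X0 X1 /andP[X2 X3]] := strip_slope st; case: st => a0 _ _ _ _.
have E : hit i = offset i - 1 by exact: hit_upper.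
move: ip => /andP[pi iq].
have gt : slope < hit i.
  rewrite E offset_upper; last by lia.
  have : 2 * p%:R + 1 <= i%:R :> R by rewrite -natrM natr1 ler_nat mul2n.
  by lra.
move: iq; rewrite leq_eqVlt => /orP[/eqP iq|iq].
  have S : offset i = 2 * slope.
    rewrite offset_upper ?iq ?leqnn ?leq_addr// /slope /nbounce.
    by rewrite natrD -!mul2n !natrM; ring.
  have H : hit i.+1 = 2 * slope by rewrite iq hit_last.
  by split; lra.
have F : hit i.+1 = offset i + 1.
  rewrite hit_upper ?offset_upper; try (rewrite /nbounce in iq *; lia).
  by rewrite -[i.+1%:R]natr1; ring.
have : i%:R + 1 <= 2 * p%:R + 2 * q%:R :> R.
  by rewrite natr1 -!natrM -natrD ler_nat !mul2n.
have S : offset i = 4 * a * p%:R + 2 * (i%:R - 2 * p%:R).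
  by rewrite offset_upper//; lia.
have : slope = 2 * (a * p%:R + q%:R) by [].
by split; lra.
Qed.

(* The two halves of the table cover the segment; s is the height scaled by
   the slope, so that s = slope is the line y = 1. *)
Lemma step_cases i (s : R) : strip -> (i <= nbounce)%N ->
  hit i <= s <= hit i.+1 ->
  [/\ 0 <= s <= 2 * slope,
   s <= slope -> (i <= p.*2)%N /\ (hit i < s < hit i.+1 -> `|s - offset i| < a) &
   slope <= s -> (p.*2 <= i)%N /\ (hit i < s < hit i.+1 -> `|s - offset i| < 1)].
Proof.
move=> st iq /andP[s1 s2].
have [X0 /andP[X1 X2] /andP[X3 X4]] := strip_slope st.
have a0 : 0 < a by case: st.
have [ip|ip|ip] := ltngtP i p.*2.
- have [/andP[h1 h2] h3 h4 h5] := step_lower st ip.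
  split; [lra | move=> _; split=> // /andP[? ?] | by lra].
  by rewrite ltr_norml; apply/andP; split; lra.
- have [h1 /andP[h2 h3] h4 h5] : [/\ hit i = offset i - 1,
      0 <= hit i.+1 - offset i <= 1, hit i.+1 <= 2 * slope & slope < hit i].
    by apply: step_upper => //; rewrite ip iq.
  split; [lra | by lra | move=> _; split=> // /andP[? ?]].
  by rewrite ltr_norml; apply/andP; split; lra.
- have [h1 h2 h3] := step_middle st; rewrite ip in s1 s2 *.
  have p1 : a <= a * p%:R by rewrite ler_pMr// ler1n; case: st.
  have q1 : 1 <= q%:R :> R by rewrite ler1n; case: st.
  have XE : slope = 2 * (a * p%:R + q%:R) by [].
  split; [lra | |]; move=> ?; split=> // /andP[? ?];
  by rewrite ltr_norml; apply/andP; split; lra.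
Qed.

End Trajectory.

(** * The paths are trajectories, and a point blocks only finitely many *)

Section Blocking.
Variables (R : realType) (a : R).
Local Notation plane := (R^o * R^o)%type.

Lemma signr_cases i : (-1) ^+ i = 1 :> R \/ (-1) ^+ i = -1 :> R.
Proof. by rewrite -signr_odd; case: odd; [right | left]. Qed.

Lemma hit_lt p q i : strip a p q -> (i <= nbounce p q)%N ->
  hit a p q i < hit a p q i.+1.
Proof.
move=> st iq; have a0 : 0 < a by case: st.
have [ip|ip|ip] := ltngtP i p.*2.
- by have [] := step_lower st ip; lra.
- by have [|] := @step_upper _ _ _ _ i st; [rewrite ip|lra].
- by have [] := step_middle st; rewrite ip; lra.
Qed.

Lemma strip_trajectory L1 L2 p q : a != 1 -> 1 < L1 -> 1 < L2 -> strip a p q ->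
  billiard_trajectory (table a L1 L2) (0, 0) (0, 2%:R) (nbounce p q).+1
    (vertex a p q).
Proof.
move=> a1 hL1 hL2 st; have [X0 _ _] := strip_slope st.
have a0 : 0 < a by case: st.
have L1_gt0 : 0 < L1 by lra.
have L2_gt0 : 0 < L2 by lra.
split=> //.
- by rewrite /vertex hit0 offset_lower// mulr0 subrr mulr0 mul0r.
- rewrite /vertex hit_last offset_last offset_upper ?leqnn ?leq_addr//.
  congr pair; last by rewrite mulfK// gt_eqF.
  by rewrite /slope /nbounce natrD -!mul2n !natrM; ring.
- move=> i iq; split.
    apply/eqP => /(congr1 snd) /= /(mulIf (invr_neq0 (lt0r_neq0 X0))) E.
    by have := hit_lt st iq; rewrite E ltxx.
  move=> z [r /=]; rewrite in_itv /= => /andP[r0 r1] <-.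
  rewrite vertex_segment; set s := hit a p q i + _; have lt := hit_lt st iq.
  have hs : hit a p q i < s < hit a p q i.+1.
    by rewrite /s; apply/andP; split; nra.
  have [|/andP[s0 s2] lo hi] := @step_cases _ _ _ _ i s st iq.
    by case/andP: hs => *; rewrite !ltW.
  have norm_sign (u : R) : `|(-1) ^+ i * u| = `|u|.
    by rewrite normrM normrX normrN1 expr1n mul1r.
  apply: table_interior => //.
  + rewrite ltr_pdivlMr// ltr_pdivrMr//; apply/andP; split; nra.
  + rewrite ler_pdivrMr// mul1r => /lo [_ /(_ hs)].
    by rewrite -norm_sign ltr_norml.
  + rewrite ler_pdivlMr// mul1r => /hi [_ /(_ hs)].
    by rewrite -norm_sign ltr_norml.
- move=> i iq.
  have iq' : (i <= nbounce p q)%N by exact: ltnW.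
  have lt1 := hit_lt st iq'; have lt2 := @hit_lt p q i.+1 st iq.
  pose w : R := (-1) ^+ i.+1 * (hit a p q i.+1 - offset a p q i.+1).
  pose y : R := hit a p q i.+1 / slope a p q.
  (* The first [2 p] bounces are on the lower walls, the remaining ones on the upper walls. *)
  have [y0 [y1 [sd yy]]] : exists y0 y1 : R,
      side (table a L1 L2) (w, y0) (w, y1) /\ y0 < y < y1.
    have [ip|ip] := leqP i.+1 p.*2.
      have [h1 h2 h3 h4] := step_lower st ip.
      exists (1 - L1), 1; split.
        apply: lower_wall => //; rewrite /w hit_lower//.
        by rewrite (_ : _ - a - _ = - a); [case: (signr_cases i.+1) => ->; lra|ring].
      by rewrite /y ltr_pdivlMr// ltr_pdivrMr//; apply/andP; split; nra.
    have [h1 h2 h3 h4] : [/\ hit a p q i.+1 = offset a p q i.+1 - 1,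
        0 <= hit a p q i.+2 - offset a p q i.+1 <= 1,
        hit a p q i.+2 <= 2 * slope a p q & slope a p q < hit a p q i.+1].
      by apply: step_upper => //; rewrite ip.
    exists 1, (1 + L2); split.
      apply: upper_wall => //; rewrite /w h1.
      by rewrite (_ : _ - 1 - _ = - 1); [case: (signr_cases i.+1) => ->; lra|ring].
    by rewrite /y ltr_pdivlMr// ltr_pdivrMr//; apply/andP; split; nra.
  apply: (@reflected_at_vertical R _ w y0 y1 y ((-1) ^+ i.+1 * slope a p q)
    ((hit a p q i.+1 - hit a p q i) / slope a p q)
    ((hit a p q i.+2 - hit a p q i.+1) / slope a p q)) => //.
  + by rewrite divr_gt0// subr_gt0.
  + by rewrite divr_gt0// subr_gt0.
  + rewrite /w -[_ * (_ - _)]/(vertex a p q i.+1).1 vertexS1 /y /vertex.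
    by congr pair => /=; rewrite ?exprS; field; rewrite gt_eqF.
  + rewrite [vertex _ _ _ _]surjective_pairing vertexS1 /w /y /vertex.
    by congr pair => /=; field; rewrite gt_eqF.
Qed.

Lemma trajectory_supportP p q (x y : R) : strip a p q ->
  trajectory_support (nbounce p q).+1 (vertex a p q) (x, y) ->
  exists i (s : R), [/\ (i <= nbounce p q)%N, hit a p q i <= s <= hit a p q i.+1,
    x = (-1) ^+ i * (s - offset a p q i) & s = y * slope a p q].
Proof.
move=> st [i /= iq] [r /=]; rewrite in_itv /= => /andP[r0 r1].
rewrite vertex_segment => -[<- <-].
have [X0 _ _] := strip_slope st; have lt := hit_lt st iq.
exists i, (hit a p q i + r * (hit a p q i.+1 - hit a p q i)); split=> //.
  by apply/andP; split; nra.
by rewrite divfK// gt_eqF.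
Qed.

Lemma blocked_bounded (x y : R) : irrational a -> 0 < a ->
  (x, y) <> (0, 0) -> (x, y) <> (0, 2) ->
  exists N : nat, forall p, (N < p)%N -> forall q, strip a p q ->
    ~ trajectory_support (nbounce p q).+1 (vertex a p q) (x, y).
Proof.
move=> ia a0 neqO neqA.
(* Both signs of the folded abscissa are allowed, so the larger of two strip bounds is taken. *)
have bounded (z b : R) : b != 0 -> exists N : nat, forall p q (k : int),
    strip a p q -> z != 0 ->
    (exists2 e, e = x \/ e = - x &
      z * (a * p%:R + q%:R) = e / 2 + b * k%:~R) -> (p <= N)%N.
  move=> b0; have [->|z0] := eqVneq z 0; first by exists 0%N.
  have [N hN] := strip_solutions_bounded (x / 2) ia b0 z0.
  have [N' hN'] := strip_solutions_bounded (- x / 2) ia b0 z0.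
  exists (maxn N N') => p q k [_ _ _ h _] _ [e he E].
  have {}h : `|q%:~R - a * p%:~R| < 1 by rewrite -!pmulrn; lra.
  by rewrite leq_max -!lez_nat; case: he E => -> E;
    [rewrite (hN p q k)|rewrite (hN' p q k) ?orbT].
(* The lower half is measured from [O], with walls [2 a] apart; the upper half from [A], with depth
   [2 - y] and walls 2 apart. Halving the equations leaves the periods [a] and 1. *)
have [N hN] := bounded y a (lt0r_neq0 a0).
have [N' hN'] := bounded (2 - y) 1 (oner_neq0 _).
exists (maxn N N') => p; rewrite gtn_max => /andP[Np N'p] q st.
move=> /(trajectory_supportP st) [i [s [iq hs Ex Es]]].
have [X0 _ _] := strip_slope st.
have XE : slope a p q = 2 * (a * p%:R + q%:R) by [].
have sE : s = 2 * (y * (a * p%:R + q%:R)) by rewrite Es XE; ring.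
have [s02 lo hi] := step_cases st iq hs.
have [/lo [ip _]|/ltW /hi [ip _]] := leP s (slope a p q).
  have oE : offset a p q i = 2 * a * i%:R by rewrite offset_lower.
  (* At height 0 the strip equation degenerates, but the path is there only at its start [O]. *)
  have [y0|y0] := eqVneq y 0.
    have i0 : i = 0%N.
      apply/eqP; case: posnP => // i0; move: hs.
      rewrite hit_lower ?i0// oE Es y0 mul0r => /andP[h _].
      have : 1 <= i%:R :> R by rewrite ler1n.
      by move=> /(ler_wpM2l (ltW a0)); lra.
    by apply: neqO; rewrite Ex oE Es y0 i0 mul0r mulr0 subrr mulr0.
  suff : (p <= N)%N by rewrite leqNgt Np.
  apply: (hN p q i%:Z st y0); exists ((-1) ^+ i * x).
    by case: (signr_cases i) => ->; rewrite ?mul1r ?mulN1r; [left|right].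
  by move: Ex; rewrite -pmulrn; case: (signr_cases i) => ->; lra.
have oE : offset a p q i = 4 * a * p%:R + 2 * (i%:R - 2 * p%:R).
  by rewrite offset_upper// ip.
have nE : (nbounce p q)%:R = 2 * p%:R + 2 * q%:R :> R.
  by rewrite /nbounce natrD -!mul2n !natrM.
(* Likewise the path reaches height 2 only at its end [A]. *)
have [y2|y2] := eqVneq (2 - y) 0.
  have {}y2 : y = 2 by lra.
  have iE : i = nbounce p q.
    apply/eqP; rewrite eqn_leq iq /= leqNgt; apply/negP => iq'; move: hs.
    rewrite [hit _ _ _ i.+1]hit_upper ?offset_upper ?Es ?y2 ?ltnS ?(leqW ip) ?ip//.
    have : i%:R + 1 <= (nbounce p q)%:R :> R by rewrite natr1 ler_nat.
    by rewrite nE -[i.+1%:R]natr1 => ? /andP[_ ?]; lra.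
  apply: neqA; rewrite Ex y2 oE Es iE nE y2 XE; congr pair; ring.
suff : (p <= N')%N by rewrite leqNgt N'p.
(* The integer counts the bounces left before [A]; the terms in [a p] cancel. *)
apply: (hN' p q ((nbounce p q)%:Z - i%:Z) st y2); exists (- ((-1) ^+ i * x)).
  by case: (signr_cases i) => ->; rewrite ?mul1r ?mulN1r ?opprK; [right|left].
by move: Ex; rewrite intrB -!pmulrn nE; case: (signr_cases i) => ->; lra.
Qed.

End Blocking.

(** * Conclusion for a finite set of blocking points *)

Lemma finite_eventually (T : choiceType) (B : set T) (Q : T -> nat -> Prop) :
  finite_set B -> (forall b, B b -> exists N, forall n, (N < n)%N -> Q b n) ->
  exists N, forall n, (N < n)%N -> forall b, B b -> Q b n.
Proof.
move=> /finite_seqP [s ->]; elim: s => [|b s IH] BQ; first by exists 0%N.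
have [|N hN] := IH; first by move=> c cs; apply: BQ; rewrite /= inE cs orbT.
have [|M hM] := BQ b; first by rewrite /= inE eqxx.
exists (maxn N M) => n; rewrite gtn_max => /andP[Nn Mn] c /=.
by rewrite inE => /orP[/eqP -> | cs]; [exact: hM | exact: hN].
Qed.

Theorem mainTheorem1 (R : realType) (alpha L1 L2 : R)
    (alpha_gt0 : 0 < alpha) (alpha_irrational : @irrational R alpha)
    (L1_gt1 : 1 < L1) (L2_gt1 : 1 < L2) :
  ~ finite_blocking_property (table alpha L1 L2).
Proof.
have alpha1 : alpha != 1.
  by apply/eqP => a1; apply: alpha_irrational; exists 1 => //; rewrite rmorph1.
move=> /(_ (0, 0) (0, 2%:R)) [||B [finB _ BO BA blockB]].
- by apply/tableP; lra.
- by apply/tableP; lra.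
have [|N hN] := @finite_eventually _ B (fun b p => forall q, strip alpha p q ->
    ~ trajectory_support (nbounce p q).+1 (vertex alpha p q) b) finB.
  by move=> [x y] Bxy; apply: blocked_bounded => // E; rewrite E in Bxy.
have [p [q [Np q0 h1 h2]]] := strip_unbounded N alpha_gt0 alpha_irrational.
have st : strip alpha p q by split=> //; lia.
have [b Bb] := blockB _ _ (strip_trajectory alpha1 L1_gt1 L2_gt1 st).
exact: hN p Np b Bb q st.
Qed.
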